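(* Let $\{\boldsymbol X_t\}_{t=0}^\infty$ be a weakly stationary $q$-dimensional process with spectral density matrix $f$, let $\Theta\subseteq(-0.5,0.5)^q$, and let $\boldsymbol d_0=(d_1^0,\dots,d_q^0)'\in\Theta$ be the true fractional differencing vector. Let $f_n=(f_n^{rs})_{r,s=1}^q$ be an estimator of $f$ satisfying, for $1\le u<v\le m$ and $\boldsymbol d_0\in\Theta$, $$\max_{r,s\in\{1,\dots,q\}}\bigg|\sum_{j=u}^v\Big[e^{\mathrm i(\lambda_j-\pi)(d_r^0-d_s^0)/2}\lambda_j^{d_r^0+d_s^0}f_n^{rs}(\lambda_j)-G_0^{rs}\Big]\bigg|=o_{\mathbb P}(1)\quad\text{as }n\to\infty .$$ Let $\widehat{\boldsymbol d}:=\arg\min_{\boldsymbol d\in\Theta}S(\boldsymbol d)$, where $S$ is the objective function based on $f_n$ given in the context. Assume that Assumptions A1–A4 (listed in the context) hold. Then $\widehat{\boldsymbol d}\overset{\mathbb P}{\to}\boldsymbol d_0$ as $n\to\infty$.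
   Context: **Spectral density.** $f=(f_{rs})_{r,s=1}^q$ is the spectral density matrix of $\{\boldsymbol X_t\}$: $\mathbb E[(\boldsymbol X_t-\mathbb E\boldsymbol X_t)(\boldsymbol X_{t+h}-\mathbb E\boldsymbol X_t)']=\int_{-\pi}^{\pi}e^{\mathrm i h\lambda}f(\lambda)\,d\lambda$. $G_0=(G_0^{rs})_{r,s=1}^q$ is a real, symmetric, positive definite matrix (the matrix appearing in A1). **Notation.** $M^*$ is the conjugate transpose of $M$; $(M)_{r\cdot}$ and $(M)_{\cdot s}$ are the $r$-th row and $s$-th column of $M$; $\|\cdot\|_\infty$ is the sup-norm. **Estimator.** $f_n$ is an estimator of $f$ based on the observations $\boldsymbol X_1,\dots,\boldsymbol X_n$; $\lambda_j:=2\pi j/n$ for $j=1,\dots,m$, where $m=m(n)=o(n)$. The objective function is $$S(\boldsymbol d):=\log\det\widehat G(\boldsymbol d)-2\sum_{k=1}^q d_k\frac1m\sum_{j=1}^m\log(\lambda_j),\qquad \widehat G(\boldsymbol d):=\frac1m\sum_{j=1}^m\mathrm{Re}\Big[\mathrm{diag}_{i}\{\lambda_j^{d_i}\}\,f_n(\lambda_j)\,\mathrm{diag}_{i}\{\lambda_j^{d_i}\}\Big],$$ with $\boldsymbol d=(d_1,\dots,d_q)'$ and $i$ ranging over $\{1,\dots,q\}$. $\Theta$ is the space of admissible estimates. **Assumptions.** A1. As $\lambda\to0^+$, $f_{rs}(\lambda)=e^{\mathrm i\pi(d_r^0-d_s^0)/2}G_0^{rs}\lambda^{-d_r^0-d_s^0}+o(\lambda^{-d_r^0-d_s^0})$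 for all $r,s=1,\dots,q$. A2. $\{\boldsymbol X_t\}$ is a causal linear process: $\boldsymbol X_t-\mathbb E(\boldsymbol X_t)=\sum_{k=0}^\infty A_k\boldsymbol\varepsilon_{t-k}$ with $\sum_{k=0}^\infty\|A_k\|_\infty^2<\infty$, where $\{\boldsymbol\varepsilon_t\}_{t\in\mathbb Z}$ is a square integrable martingale difference in the sense that $\mathbb E(\boldsymbol\varepsilon_t|\mathscr F_{t-1})=0$ and $\mathbb E(\boldsymbol\varepsilon_t\boldsymbol\varepsilon_t'|\mathscr F_{t-1})=\mathrm I_q$ a.s. for all $t\in\mathbb Z$, with $\mathscr F_t$ the $\sigma$-field generated by $\{\boldsymbol\varepsilon_s,s\le t\}$. Moreover there exist a random variable $\xi$ and a constant $K>0$ such that $\mathbb E(\xi^2)<\infty$ and $\mathbb P(\|\boldsymbol\varepsilon_t\|_\infty^2>\eta)\le K\,\mathbb P(\xi^2>\eta)$ for all $\eta>0$. A3. Let $A(\lambda):=\sum_{k=0}^\infty A_ke^{\mathrm ik\lambda}$. In a neighborhood $(0,\delta)$, $\delta>0$, of the origin, $A$ is differentiable and $\frac{\partial}{\partial\lambda}\big(A(\lambda)^*\big)_{r\cdot}=O\big(\lambda^{-1}\|(A(\lambda)^* )_{r\cdot}\|_\infty\big)$ as $\lambda\to0^+$ (for each $r$). A4. $\frac1m+\frac mn\to0$ as $n\to\infty$. *)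

(* Defs.v *)
From HB Require Import structures.
From mathcomp Require Import all_boot all_order all_algebra.
From mathcomp Require Import all_classical all_reals all_analysis.
From mathcomp Require Import complex.
Import Order.TTheory GRing.Theory Num.Theory.
Import numFieldNormedType.Exports.
Set Implicit Arguments.
Unset Strict Implicit.
Unset Printing Implicit Defensive.
Local Open Scope classical_set_scope.
Local Open Scope complex_scope.
Local Open Scope ring_scope.

Section ComplexValued.
Variable R : realType.

(* The norm of a normed module over R[i] takes its values in R[i]; on matrices
   it is the largest modulus of an entry. *)
Definition rnorm (V : normedZmodType R[i]) (v : V) : R := complex.Re `|v|.

Definition expi (x : R) : R[i] := cos x +i* sin x.

Definition conjtr (m n : nat) (M : 'M[R[i]]_(m, n)) : 'M[R[i]]_(n, m) :=
  map_mx conjc M^T.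

Definition cintegrable (D : set R) (g : R -> R[i]) : Prop :=
  (@lebesgue_measure R).-integrable D (fun x => (complex.Re (g x))%:E) /\
  (@lebesgue_measure R).-integrable D (fun x => (complex.Im (g x))%:E).

Definition cintegral (D : set R) (g : R -> R[i]) : R[i] :=
  Rintegral (@lebesgue_measure R) D (fun x => complex.Re (g x)) +i*
  Rintegral (@lebesgue_measure R) D (fun x => complex.Im (g x)).

Definition cderivable (g : R -> R[i]) (x : R) : Prop :=
  derivable (fun y => complex.Re (g y)) x 1 /\
  derivable (fun y => complex.Im (g y)) x 1.

Definition cderive (g : R -> R[i]) (x : R) : R[i] :=
  derive1 (fun y => complex.Re (g y)) x +i*
  derive1 (fun y => complex.Im (g y)) x.

Definition ccvg (u : nat -> R[i]) : Prop :=
  cvgn (fun n => complex.Re (u n)) /\ cvgn (fun n => complex.Im (u n)).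

Definition clim (u : nat -> R[i]) : R[i] :=
  limn (fun n => complex.Re (u n)) +i* limn (fun n => complex.Im (u n)).

End ComplexValued.

Section Probability.
Context (R : realType) (dT : measure_display) (T : measurableType dT)
        (P : probability T R).

Definition cvg_in_prob (V : normedZmodType R) (Z : nat -> T -> V) (z : V) :
  Prop :=
  forall e : R, 0 < e ->
    P [set w | e < `|Z n w - z|] @[n --> \oo] --> (0 : \bar R)%E.

(* The sigma-field generated by the random variables (Y i), i in D. *)
Definition sigma_of (I : Type) (D : set I) (Y : I -> T -> R) :
  set (set T) :=
  <<s \bigcup_(i in D) [set (Y i) @^-1` C | C in measurable] >>.

Definition measurable_wrt (F : set (set T)) (Y : T -> R) : Prop :=
  forall C : set R, measurable C -> F (Y @^-1` C).

(* Z is a version of the conditional expectation of Y given F. *)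
Definition is_cond_expectation (F : set (set T)) (Y Z : T -> R) : Prop :=
  [/\ P.-integrable setT (EFin \o Y),
      P.-integrable setT (EFin \o Z),
      measurable_wrt F Z
    & forall B, F B ->
        (\int[P]_(w in B) (Y w)%:E = \int[P]_(w in B) (Z w)%:E)%E].

End Probability.

Section Model.
Context (R : realType) (dT : measure_display) (T : measurableType dT)
        (P : probability T R) (q : nat).

Definition rvec (Y : 'I_q -> {RV P >-> R}) (w : T) : 'cV[R]_q :=
  \col_i Y i w.

Definition weakly_stationary (X : nat -> 'I_q -> {RV P >-> R}) : Prop :=
  [/\ forall t r, P.-integrable setT (fun w => ((X t r w) ^+ 2)%:E),
      forall t r, ('E_P[X t r] = 'E_P[X 0%N r])%E
    & forall t t' h r s,
        covariance P (X (t + h)%N r) (X (t' + h)%N s) =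
        covariance P (X t r) (X t' s)].

(* The lag is t' - t, which ranges over all integers. *)
Definition spectral_density (X : nat -> 'I_q -> {RV P >-> R})
  (f : R -> 'M[R[i]]_q) : Prop :=
  (forall r s, cintegrable `[- pi, pi] (fun lam => f lam r s)) /\
  (forall t t' r s,
     (fine (covariance P (X t r) (X t' s)))%:C =
     cintegral `[- pi, pi]
       (fun lam => expi ((t'%:R - t%:R) * lam) * f lam r s)).

Definition pos_def (G : 'M[R]_q) : Prop :=
  G^T = G /\ forall x : 'cV[R]_q, x != 0 -> 0 < (x^T *m G *m x) 0 0.

Definition A1 (f : R -> 'M[R[i]]_q) (G0 : 'M[R]_q) (d0 : 'cV[R]_q) : Prop :=
  forall r s (e : R), 0 < e ->
    \forall lam \near 0^'+,
      rnorm (f lam r s -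
             expi (pi * (d0 r 0 - d0 s 0) / 2) *
             (G0 r s * lam `^ (- d0 r 0 - d0 s 0))%:C)
      <= e * lam `^ (- d0 r 0 - d0 s 0).

Definition natural_filtration (eps : int -> 'I_q -> {RV P >-> R}) (t : int) :
  set (set T) :=
  sigma_of [set i : int * 'I_q | (i.1 <= t)%R] (fun i => eps i.1 i.2).

Definition martingale_difference (eps : int -> 'I_q -> {RV P >-> R}) : Prop :=
  forall t : int,
    (forall r, is_cond_expectation P (natural_filtration eps (t - 1))
                 (eps t r) (cst 0)) /\
    (forall r s, is_cond_expectation P (natural_filtration eps (t - 1))
                 (fun w => eps t r w * eps t s w)
                 (cst ((1%:M : 'M[R]_q) r s))).

(* The infinite moving average is understood in mean square. *)
Definition A2 (X : nat -> 'I_q -> {RV P >-> R}) (A : nat -> 'M[R]_q)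
  (eps : int -> 'I_q -> {RV P >-> R}) : Prop :=
  [/\ cvgn (series (fun k => `|A k| ^+ 2)),
      martingale_difference eps,
      forall t r,
        ('E_P[(fun w => ((X t r w - fine 'E_P[X t r]%E
                 - (\sum_(0 <= k < N)
                      A k *m rvec (eps (t%:Z - k%:Z)) w) r 0) ^+ 2)%R)])%E
          @[N --> \oo] --> (0 : \bar R)%E
    & exists (xi : {RV P >-> R}) (K : R),
        [/\ 0 < K,
            P.-integrable setT (fun w => ((xi w) ^+ 2)%:E)
          & forall (t : int) (eta : R), 0 < eta ->
              (P [set w | (eta < `|rvec (eps t) w| ^+ 2)%R]
               <= K%:E * P [set w | (eta < (xi w) ^+ 2)%R])%E]].

Definition transfer_partial (A : nat -> 'M[R]_q) (lam : R) (N : nat) :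
  'M[R[i]]_q :=
  \sum_(0 <= k < N) expi (k%:R * lam) *: map_mx (fun x : R => x%:C) (A k).

Definition transfer (A : nat -> 'M[R]_q) (lam : R) : 'M[R[i]]_q :=
  \matrix_(r, s) clim (fun N => transfer_partial A lam N r s).

Definition A3 (A : nat -> 'M[R]_q) : Prop :=
  (exists2 delta : R, 0 < delta &
     forall lam : R, 0 < lam < delta -> forall r s,
       ccvg (fun N => transfer_partial A lam N r s) /\
       cderivable (fun x => transfer A x r s) lam) /\
  (forall r, exists C : R,
     \forall lam \near 0^'+,
       rnorm (\row_s cderive (fun x => conjtr (transfer A x) r s) lam)
       <= C * (lam^-1 * rnorm (row r (conjtr (transfer A lam))))).

Definition A4 (m : nat -> nat) : Prop :=
  (((m n)%:R : R)^-1 + (m n)%:R / n%:R) @[n --> \oo] --> (0 : R).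

Definition freq (n j : nat) : R := 2 * pi * j%:R / n%:R.

(* f_n(lam) depends on the data only through X_1, ..., X_n. *)
Definition based_on_observations (X : nat -> 'I_q -> {RV P >-> R})
  (fn : nat -> R -> T -> 'M[R[i]]_q) : Prop :=
  forall n lam r s, (0 < n)%N ->
    let F := sigma_of [set i : nat * 'I_q | (1 <= i.1 <= n)%N]
               (fun i => X i.1 i.2) in
    measurable_wrt F (fun w => complex.Re (fn n lam w r s)) /\
    measurable_wrt F (fun w => complex.Im (fn n lam w r s)).

Definition max_discrepancy (fn : nat -> R -> T -> 'M[R[i]]_q)
  (G0 : 'M[R]_q) (d0 : 'cV[R]_q) (m : nat -> nat) (n : nat) (w : T) : R :=
  \big[Num.max/0]_(1 <= u < (m n).+1)
  \big[Num.max/0]_(u.+1 <= v < (m n).+1)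
  \big[Num.max/0]_(r < q) \big[Num.max/0]_(s < q)
    rnorm (\sum_(u <= j < v.+1)
      (expi ((freq n j - pi) * (d0 r 0 - d0 s 0) / 2) *
       (freq n j `^ (d0 r 0 + d0 s 0))%:C * fn n (freq n j) w r s
       - (G0 r s)%:C)).

Definition Ghat (fn : nat -> R -> T -> 'M[R[i]]_q) (m : nat -> nat)
  (n : nat) (w : T) (d : 'cV[R]_q) : 'M[R]_q :=
  (m n)%:R^-1 *: \sum_(1 <= j < (m n).+1)
    map_mx (@complex.Re R)
      (let D := diag_mx (\row_i (freq n j `^ d i 0)%:C) in
       D *m fn n (freq n j) w *m D).

(* [lne] extends the logarithm by log x = -oo for x <= 0, so that the objective
   function is defined also where the determinant is not positive. *)
Definition objective (fn : nat -> R -> T -> 'M[R[i]]_q) (m : nat -> nat)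
  (n : nat) (w : T) (d : 'cV[R]_q) : \bar R :=
  (lne (\det (Ghat fn m n w d))%:E
   - (2 * \sum_(k < q) d k 0 *
        ((m n)%:R^-1 * \sum_(1 <= j < (m n).+1) ln (freq n j)))%:E)%E.

Definition is_argmin (Theta : set 'cV[R]_q) (S : 'cV[R]_q -> \bar R)
  (d : 'cV[R]_q) : Prop :=
  Theta d /\ forall d', Theta d' -> (S d <= S d')%E.

End Model.

(* Main.v *)
Require Import Defs.
From HB Require Import structures.
From mathcomp Require Import all_boot all_order all_algebra.
From mathcomp Require Import all_classical all_reals all_analysis.
From mathcomp Require Import perm complex.
From mathcomp Require Import ring lra zify.
Import Order.TTheory GRing.Theory Num.Theory.
Import numFieldNormedType.Exports.
Set Implicit Arguments.
Unset Strict Implicit.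
Unset Printing Implicit Defensive.
Local Open Scope classical_set_scope.
Local Open Scope ring_scope.

(** The discrepancy in the hypothesis bounds sums over windows without
    averaging them, so it bounds every single summand (rnorm_term_le).  As the
    frequencies tend to 0, this makes the real parts
    M_j = Re (lambda_j^(d0_r + d0_s) f_n^rs(lambda_j)) uniformly close, with
    probability tending to 1, to one fixed matrix
    G_rs = G0_rs cos (pi (d0_r - d0_s) / 2).  This G is positive definite: it is
    C G0 C + S G0 S with C and S the diagonal matrices of the cosines and sines
    of pi d0_r / 2.  On that event the rest of the argument is deterministic.

    Put theta = d - d0.  Subtracting from log lambda_j its mean over j absorbs
    the linear term of the objective function: up to a constant that does not
    depend on d, S(d) is the logarithm of the determinant of
      H(theta) = (1/m) sum_j D_j M_j D_j,   D_j = diag (w_jr),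
      w_jr = exp (theta_r (log j - mean of log k)).
    A minimiser far from d0 is excluded by det H(theta) > det H(0), uniformly
    in theta away from 0, and this is det_separation.  For M_j = G it follows
    from Oppenheim's inequality (oppenheim_gram),
      det H(theta) >= det G * prod_r (1/m) sum_j w_jr^2,
    and from a quantitative Jensen inequality: each factor is at least 1, and
    the factor of a coordinate with |theta_r| >= e is at least 1 + c(e), because
    the numbers log j stay spread out (mean_spread_ge).

    The exponents theta_r may be so negative that the entries of H(theta)
    diverge with m, so an additive perturbation bound is of no use.  Dividing
    row and column r of H(theta) by the root of its mean square weight turns
    the matrix into one with bounded entries in which replacing M_j by G costs
    at most the uniform error, and there the determinant is Lipschitz
    (weighted_det_ge). *)

(** * Positive definite matrices and Oppenheim's inequality *)

Section PosDef.
Context (R : realType).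

Definition qform (q : nat) (G : 'M[R]_q) (x : 'cV[R]_q) : R :=
  (x^T *m G *m x) 0 0.

Lemma qformE q (G : 'M[R]_q) x :
  qform G x = \sum_r \sum_s G r s * (x r 0 * x s 0).
Proof.
rewrite /qform mxE exchange_big; apply: eq_bigr => s _.
rewrite mxE mulr_suml; apply: eq_bigr => r _.
by rewrite !mxE; ring.
Qed.

(** The Hadamard product of G with the Gram matrix of the vectors
    (w j r)_j; equivalently the sum over j of D_j G D_j with D_j = diag (w j). *)
Definition hadamard_gram (q : nat) (J : finType) (G : 'M[R]_q)
  (w : J -> 'I_q -> R) : 'M[R]_q :=
  \matrix_(r, s) (G r s * \sum_j w j r * w j s).

Lemma qform_hadamard_gram q (J : finType) (G : 'M[R]_q) (w : J -> 'I_q -> R) x :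
  qform (hadamard_gram G w) x = \sum_j qform G (\col_r (w j r * x r 0)).
Proof.
under [RHS]eq_bigr => j _ do rewrite qformE.
rewrite qformE [RHS]exchange_big; apply: eq_bigr => r _.
rewrite [RHS]exchange_big; apply: eq_bigr => s _.
rewrite mxE mulr_sumr mulr_suml; apply: eq_bigr => j _.
by rewrite !mxE; ring.
Qed.

Lemma pos_def_qform_ge0 q (G : 'M[R]_q) x : pos_def G -> 0 <= qform G x.
Proof.
move=> [_ pG]; have [->|/pG/ltW//] := eqVneq x 0.
by rewrite /qform mulmx0 mxE.
Qed.

Lemma pos_def_unitmx q (G : 'M[R]_q) : pos_def G -> G \in unitmx.
Proof.
move=> [_ pG]; rewrite -row_free_unit -kermx_eq0.
apply/negP => /negP/rowV0Pn[v /sub_kermxP vG vn0].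
have := pG v^T; rewrite trmxK vG mul0mx mxE ltxx => /(_ _)/negP; apply => //.
by rewrite -trmx0 (inj_eq trmx_inj).
Qed.

Lemma pos_def_hadamard_gram q (J : finType) (G : 'M[R]_q)
  (w : J -> 'I_q -> R) :
  pos_def G -> (forall r, 0 < \sum_j w j r ^+ 2) ->
  pos_def (hadamard_gram G w).
Proof.
move=> pG w_gt0; have [symG posG] := pG; split.
  apply/matrixP => r s; rewrite !mxE -{1}symG mxE.
  by congr (_ * _); apply: eq_bigr => j _; rewrite mulrC.
move=> x xn0; rewrite -/(qform _ _) qform_hadamard_gram lt_def.
have qge0 j : true -> 0 <= qform G (\col_r (w j r * x r 0)).
  by move=> _; exact: pos_def_qform_ge0.
rewrite sumr_ge0 // andbT; apply: contra xn0 => /eqP/(psumr_eq0P qge0) q0.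
apply/eqP/matrixP => r i; rewrite ord1 mxE.
have wx0 j : w j r * x r 0 = 0.
  have [/matrixP/(_ r 0)|/posG] := eqVneq (\col_r (w j r * x r 0)) 0.
    by rewrite !mxE.
  by rewrite -/(qform _ _) q0 // ltxx.
have : (\sum_j w j r ^+ 2) * x r 0 = 0.
  rewrite mulr_suml big1 // => j _.
  by rewrite expr2 -mulrA wx0 mulr0.
by move/eqP; rewrite mulf_eq0 gt_eqF //= => /eqP.
Qed.

Lemma pos_def_drsubmx n (G : 'M[R]_(1 + n)) :
  pos_def G -> pos_def (drsubmx G).
Proof.
move=> [symG posG]; split; first by rewrite trmx_drsub symG.
move=> x xn0; pose y : 'cV[R]_(1 + n) := col_mx 0 x.
have yn0 : y != 0.
  apply: contra xn0 => /eqP y0.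
  by rewrite -(col_mxKd (0 : 'cV[R]_1) x) -/y y0 linear0.
have := posG _ yn0; rewrite -{1}(submxK G) /y tr_col_mx mul_row_block.
by rewrite mul_row_col trmx0 !mul0mx mulmx0 !add0r.
Qed.

(** Eliminating the last n coordinates leaves the Schur complement p of the
    first diagonal entry.  The variational description of p as the minimum of
    the form over vectors with first coordinate 1 is what makes p comparable
    between different matrices. *)
Lemma schur_complement n (G : 'M[R]_(1 + n)) : pos_def G ->
  exists p : R, [/\ \det G = p * \det (drsubmx G), 0 < p,
    forall x : 'cV[R]_(1 + n), p * x 0 0 ^+ 2 <= qform G x &
    exists2 v : 'cV[R]_(1 + n), v 0 0 = 1 & qform G v = p].
Proof.
move=> pG; have [symG posG] := pG.
have pG2 := pos_def_drsubmx pG.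
have uG2 := pos_def_unitmx pG2.
set a := ulsubmx G; set b := dlsubmx G; set C := drsubmx G in pG2 uG2 *.
have Gdef : G = block_mx a b^T b C.
  by rewrite -[LHS]submxK /b trmx_dlsub symG.
(* U is unitriangular and its congruence makes G block diagonal. *)
pose U : 'M[R]_(1 + n) := block_mx 1%:M 0 (- (invmx C *m b)) 1%:M.
have detU : \det U = 1 by rewrite det_lblock !det1 mul1r.
have CT : C^T = C by case: pG2.
pose p := (a - b^T *m invmx C *m b) 0 0.
have UGU : U^T *m G *m U = block_mx p%:M 0 0 C.
  rewrite Gdef /U tr_block_mx !trmx1 trmx0 !mulmx_block.
  rewrite !mul1mx !mulmx1 !mul0mx !mulmx0 !add0r.
  rewrite linearN /= trmx_mul trmx_inv CT.
  rewrite !mulNmx !mulmxN -[b^T *m invmx C *m C]mulmxA mulVmx // mulmx1.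
  rewrite subrr mul0mx oppr0 addr0 mulmxA mulmxV // mul1mx subrr.
  congr block_mx.
  by rewrite /p -mx11_scalar.
have UV : U \in unitmx by rewrite unitmxE detU unitr1.
have e0 : (0 : 'I_(1 + n)) = lshift n (0 : 'I_1) by apply: val_inj.
have U0 (y : 'cV[R]_(1 + n)) : (U *m y) 0 0 = y 0 0.
  rewrite -{1}(vsubmxK y) /U mul_block_col e0 col_mxEu mul1mx mul0mx addr0.
  by rewrite mxE.
have qU (y : 'cV[R]_(1 + n)) :
    qform G (U *m y) = p * y 0 0 ^+ 2 + qform C (dsubmx y).
  have -> : qform G (U *m y) = (y^T *m (U^T *m G *m U) *m y) 0 0.
    by rewrite /qform trmx_mul !mulmxA.
  rewrite UGU /qform.
  rewrite -{1 2}(vsubmxK y) tr_col_mx mul_row_block mul_row_col.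
  rewrite !mulmx0 addr0 add0r mxE; congr (_ + _).
  by rewrite mul_mx_scalar -scalemxAl !mxE big_ord1 !mxE e0 expr2.
pose v := U *m col_mx 1%:M 0 : 'cV[R]_(1 + n).
have v0 : v 0 0 = 1 by rewrite U0 e0 col_mxEu mxE.
have qv : qform G v = p.
  rewrite qU e0 col_mxEu mxE expr1n mulr1 col_mxKd /qform mulmx0 [X in _ + X]mxE.
  by rewrite addr0.
exists p; split.
- have : \det (U^T *m G *m U) = \det (block_mx p%:M 0 0 C : 'M[R]_(1 + n)).
    by rewrite UGU.
  by rewrite !det_mulmx det_tr detU mul1r mulr1 det_ublock det_scalar1.
- rewrite -qv; apply: posG; apply/eqP => v00; move: v0; rewrite v00 mxE.
  by move/eqP; rewrite eq_sym oner_eq0.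
- move=> x; rewrite -[x](mulKVmx UV) qU U0 lerDl.
  exact: pos_def_qform_ge0.
- by exists v.
Qed.

Lemma pos_def_det_gt0 n (G : 'M[R]_n) : pos_def G -> 0 < \det G.
Proof.
elim: n G => [|n IHn] G pG; first by rewrite det_mx00.
have [p [-> p0 _ _]] := schur_complement (n := n) pG.
by rewrite mulr_gt0 // IHn //; exact: (pos_def_drsubmx (n := n)).
Qed.

(** By induction on the size, the determinant is the product of the successive
    Schur complements.  Each of these is a minimum of the form over vectors x
    with x_0 = 1, and the form of the Hadamard product at x is the sum over j of
    the form of G at D_j x, whose first coordinate is w_j0; so the complement
    for the product is at least sum_j w_j0^2 times that for G. *)
Lemma oppenheim_gram n (J : finType) (G : 'M[R]_n) (w : J -> 'I_n -> R) :
  pos_def G -> (forall r, 0 < \sum_j w j r ^+ 2) ->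
  \det G * \prod_r \sum_j w j r ^+ 2 <= \det (hadamard_gram G w).
Proof.
elim: n G w => [|n IHn] G w pG w0; first by rewrite !det_mx00 big_ord0 mulr1.
pose H : 'M[R]_(1 + n) := hadamard_gram G w.
have pH : pos_def H by exact: pos_def_hadamard_gram.
have pG2 := pos_def_drsubmx (n := n) pG.
have H2 : drsubmx H = hadamard_gram (drsubmx (G : 'M[R]_(1 + n)))
                        (fun j i => w j (lift ord0 i)).
  by apply/matrixP => r s; rewrite !mxE !rshift1.
have [p [detG p0 pmin _]] := schur_complement (n := n) pG.
have [p' [detH p'0 _ [v v0 qv]]] := schur_complement pH.
rewrite -/H detH detG big_ord_recl.
have IH := IHn _ (fun j i => w j (lift ord0 i)) pG2 (fun r => w0 (lift ord0 r)).
rewrite -H2 in IH.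
have pp' : p * (\sum_j w j ord0 ^+ 2) <= p'.
  rewrite -qv qform_hadamard_gram mulr_sumr; apply: ler_sum => j _.
  apply: le_trans (pmin _); rewrite mxE v0 mulr1.
  by [].
rewrite mulrACA; apply: ler_pM => //.
  by rewrite mulr_ge0 ?ltW.
rewrite mulr_ge0 ?prodr_ge0 // => [|i _]; last exact: ltW.
by rewrite ltW // pos_def_det_gt0.
Qed.

End PosDef.

(** * Determinants of weighted sums of nearly equal matrices *)

Section Perturbation.
Context (R : realType).

Lemma prod_lipschitz (I : Type) (s : seq I) (B eta : R) (a a' : I -> R) :
  0 <= B -> 0 <= eta <= 1 ->
  (forall i, `|a i| <= B) -> (forall i, `|a' i - a i| <= eta) ->
  `|\prod_(i <- s) a' i - \prod_(i <- s) a i|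
    <= (size s)%:R * (B + 1) ^+ size s * eta.
Proof.
move=> B0 /andP[eta0 eta1] aB a'a.
have B1 : 0 <= B + 1 by lra.
have a'B i : `|a' i| <= B + 1.
  rewrite -(subrK (a i) (a' i)) [B + 1]addrC.
  apply: (le_trans (ler_normD _ _)).
  by apply: lerD => //; exact: le_trans (a'a i) eta1.
elim: s => [|i s IHs]; first by rewrite !big_nil subrr normr0 !mul0r.
rewrite !big_cons /=.
set P' := \prod_(_ <- _) a' _ in IHs *; set P := \prod_(_ <- _) a _ in IHs *.
have PB : `|P| <= (B + 1) ^+ size s.
  rewrite /P normr_prod; elim: s {IHs P' P} => [|k s IHs].
    by rewrite big_nil.
  rewrite big_cons exprS; apply: ler_pM => //; first exact: prodr_ge0.
  by apply: (le_trans (aB k)); lra.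
have -> : a' i * P' - a i * P = a' i * (P' - P) + (a' i - a i) * P by ring.
apply: (le_trans (ler_normD _ _)); rewrite !normrM.
apply: (@le_trans _ _ ((B + 1) * ((size s)%:R * (B + 1) ^+ size s * eta)
                       + eta * (B + 1) ^+ size s)).
  by apply: lerD; apply: ler_pM.
rewrite -natr1 exprS.
set k := (size s)%:R; set C := (_ ^+ _).
have C0 : 0 <= C by rewrite /C exprn_ge0.
rewrite -subr_ge0.
have -> : (k + 1) * ((B + 1) * C) * eta - ((B + 1) * (k * C * eta) + eta * C)
  = B * (eta * C) by ring.
by rewrite !mulr_ge0.
Qed.

(** A Lipschitz constant of the determinant near n x n matrices with entries
    bounded by B: one product of n entries for each permutation. *)
Definition det_modulus (n : nat) (B : R) : R :=
  #|{: {perm 'I_n}}|%:R * (n%:R * (B + 1) ^+ n).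

Lemma det_modulus_ge0 n B : 0 <= B -> 0 <= det_modulus n B.
Proof. by move=> B0; rewrite !mulr_ge0 // exprn_ge0 // addr_ge0. Qed.

Lemma det_lipschitz n (B eta : R) (A A' : 'M[R]_n) :
  0 <= B -> 0 <= eta <= 1 -> (forall r s, `|A r s| <= B) ->
  (forall r s, `|A' r s - A r s| <= eta) ->
  `|\det A' - \det A| <= det_modulus n B * eta.
Proof.
move=> B0 eta01 AB A'A; rewrite /determinant -sumrB.
apply: (le_trans (ler_norm_sum _ _ _)).
rewrite /det_modulus -mulrA mulr_natl -sumr_const; apply: ler_sum => s _.
rewrite -mulrBr normrM normr_sign mul1r.
have := prod_lipschitz (index_enum 'I_n) B0 eta01
  (fun i => AB i (s i)) (fun i => A'A i (s i)).
have -> : size (index_enum 'I_n) = n.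
  by rewrite -[RHS]card_ord cardT enumT.
by [].
Qed.

(** The weights w are arbitrary in size, yet the loss is only the fixed amount
    det_modulus * eta inside the bracket: after scaling row and column r by the
    root of sum_j w_jr^2 the weights become unit vectors v_r, the entries of
    their Gram matrix are at most 1 in absolute value, and the error of each
    entry is at most eta.  Oppenheim's inequality bounds the determinant of
    the unperturbed scaled matrix below by det G. *)
Lemma weighted_det_ge n (J : finType) (G : 'M[R]_n) (B eta : R)
  (M : J -> 'M[R]_n) (w : J -> 'I_n -> R) :
  pos_def G -> 0 <= eta <= 1 -> 0 <= B -> (forall r s, `|G r s| <= B) ->
  (forall j r s, `|M j r s - G r s| <= eta) ->
  (forall r, 0 < \sum_j w j r ^+ 2) ->
  (\prod_r \sum_j w j r ^+ 2) * (\det G - det_modulus n B * eta)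
    <= \det (\matrix_(r, s) \sum_j w j r * w j s * M j r s).
Proof.
move=> pG eta01 B0 GB MG W0.
have eta0 : 0 <= eta by case/andP: eta01.
pose W r := \sum_j w j r ^+ 2; pose v j r := w j r / Num.sqrt (W r).
have sW0 r : 0 < Num.sqrt (W r) by rewrite sqrtr_gt0 W0.
pose D : 'M[R]_n := diag_mx (\row_r Num.sqrt (W r)).
pose N : 'M[R]_n := \matrix_(r, s) \sum_j v j r * v j s * M j r s.
have -> : \matrix_(r, s) (\sum_j w j r * w j s * M j r s) = D *m N *m D.
  apply/matrixP => r s; rewrite /D mul_mx_diag mul_diag_mx !mxE.
  rewrite mulr_sumr mulr_suml.
  apply: eq_bigr => j _; rewrite /v.
  have := lt0r_neq0 (sW0 r); have := lt0r_neq0 (sW0 s).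
  by move=> ? ?; field; apply/andP.
have v1 r : \sum_j v j r ^+ 2 = 1.
  under eq_bigr => j _ do rewrite /v expr_div_n sqr_sqrtr ?(ltW (W0 r)) //.
  by rewrite -mulr_suml mulfV // gt_eqF // W0.
have vv r s : \sum_j `|v j r * v j s| <= 1.
  have -> : 1 = \sum_j (v j r ^+ 2 + v j s ^+ 2) / 2 :> R.
    by rewrite -mulr_suml big_split /= !v1; lra.
  apply: ler_sum => j _.
  have h1 := sqr_ge0 (v j r - v j s); have h2 := sqr_ge0 (v j r + v j s).
  rewrite ler_norml; apply/andP; split; rewrite ?sqrrB ?sqrrD in h1 h2 *; lra.
have detN : \det G - det_modulus n B * eta <= \det N.
  have HB r s : `|hadamard_gram G v r s| <= B.
    rewrite mxE normrM -[leRHS]mulr1; apply: ler_pM => //.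
    by apply: le_trans (vv r s); exact: ler_norm_sum.
  have NH r s : `|N r s - hadamard_gram G v r s| <= eta.
    rewrite !mxE mulr_sumr -sumrB.
    apply: (le_trans (ler_norm_sum _ _ _)).
    apply: (@le_trans _ _ (\sum_j `|v j r * v j s| * eta)).
      apply: ler_sum => j _; rewrite [G r s * _]mulrC -mulrBr normrM.
      by rewrite ler_wpM2l.
    by rewrite -mulr_suml -[leRHS]mul1r ler_wpM2r.
  have := det_lipschitz B0 eta01 HB NH.
  rewrite ler_distl => /andP[+ _]; apply: le_trans.
  rewrite lerD2r -[leLHS]mulr1.
  have v0 r : 0 < \sum_j v j r ^+ 2 by rewrite v1.
  have := oppenheim_gram pG v0.
  by under eq_bigr => r _ do rewrite v1; rewrite big1_eq.
have detD : \det D * \det D = \prod_r W r.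
  rewrite det_diag -big_split /=; apply: eq_bigr => r _.
  by rewrite mxE -expr2 sqr_sqrtr // ltW // W0.
rewrite !det_mulmx (mulrAC (\det D)) detD.
by rewrite ler_wpM2l // prodr_ge0 // => r _; exact: ltW.
Qed.

End Perturbation.

(** * Separation in the memory parameter *)

Section Separation.
Context (R : realType).

(** The square of expR (z / 2) >= 1 + z / 2 where the latter is nonnegative;
    elsewhere 2 + z <= 0 already.  The truncated square is the gain over the
    tangent line that makes Jensen's inequality quantitative. *)
Lemma expR_ge_quadratic (z : R) : 1 + z + Num.min (z ^+ 2 / 4) 1 <= expR z.
Proof.
have [zle|zgt] := leP z (- 2).
  apply: le_trans (expR_ge0 z).
  have : Num.min (z ^+ 2 / 4) 1 <= 1 by rewrite ge_min lexx orbT.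
  lra.
apply: (@le_trans _ _ ((1 + z / 2) ^+ 2)).
  have : Num.min (z ^+ 2 / 4) 1 <= z ^+ 2 / 4 by rewrite ge_min lexx.
  by rewrite sqrrD expr1n mul1r expr_div_n; lra.
have -> : expR z = expR (z / 2) ^+ 2.
  by rewrite -expRM_natl -mulr_natl; congr expR; field.
by rewrite ler_sqr ?nnegrE ?expR_ge0 ?expR_ge1Dx //; lra.
Qed.

Definition mean (m : nat) (x : 'I_m -> R) : R := m%:R^-1 * \sum_j x j.

Lemma sum_centered m (x : 'I_m -> R) : (0 < m)%N ->
  \sum_j (x j - mean x) = 0.
Proof.
move=> m0; rewrite sumrB sumr_const card_ord -mulr_natl /mean.
by rewrite mulVKf ?subrr // pnatr_eq0 -lt0n.
Qed.

Lemma mean_expR_ge m (z : 'I_m -> R) : (0 < m)%N -> \sum_j z j = 0 ->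
  1 + mean (fun j => Num.min (z j ^+ 2 / 4) 1) <= mean (fun j => expR (z j)).
Proof.
move=> m0 z0; have mn0 : m%:R != 0 :> R by rewrite pnatr_eq0 -lt0n.
have -> : 1 + mean (fun j => Num.min (z j ^+ 2 / 4) 1) =
    mean (fun j => 1 + z j + Num.min (z j ^+ 2 / 4) 1) :> R.
  rewrite /mean !big_split /= z0 addr0 mulrDr sumr_const card_ord.
  by rewrite mulVf.
rewrite ler_wpM2l ?invr_ge0 ?ler0n //; apply: ler_sum => j _.
exact: expR_ge_quadratic.
Qed.

(** Log-frequencies centred at their mean: log (freq n j) and log j differ by a
    constant, which centring removes.  The ordinal j stands for the index j + 1. *)
Definition ctr_log (m : nat) (j : 'I_m) : R :=
  ln j.+1%:R - mean (fun k : 'I_m => ln k.+1%:R).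

(** Pair j with h + j for j <= h = m / 2: the two logarithms differ by at least
    ln 2, so one of them is at distance at least ln 2 / 2 from the mean.  This
    gives at least h >= m / 3 indices with a gain bounded below. *)
Lemma mean_spread_ge (m : nat) (t e : R) : (1 < m)%N -> 0 < e -> e <= `|t| ->
  Num.min ((e * ln 2) ^+ 2 / 4) 1 / 3
    <= mean (fun j : 'I_m => Num.min ((2 * t * ctr_log j) ^+ 2 / 4) 1).
Proof.
move=> m1 e0 et; pose phi (z : R) : R := Num.min (z ^+ 2 / 4) 1.
have ln2 : 0 < ln 2 :> R by rewrite ln_gt0 //; lra.
have phi0 z : 0 <= phi z by rewrite le_min divr_ge0 ?sqr_ge0 ?ler01 ?ler0n.
have phi_mono (a b : R) : `|a| <= `|b| -> phi a <= phi b.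
  move=> ab; rewrite le_min ge_min ge_min lexx orbT andbT ler_pM2r //.
  by rewrite -(real_normK (num_real a)) -(real_normK (num_real b)) ler_sqr ?ab.
set c := Num.min _ 1; have -> : c = phi (e * ln 2) by [].
pose L := mean (fun k : 'I_m => ln (k.+1%:R : R)).
pose F (j : nat) : R := phi (2 * t * (ln j.+1%:R - L)).
have -> : mean (fun j : 'I_m => Num.min ((2 * t * ctr_log j) ^+ 2 / 4) 1)
  = m%:R^-1 * \sum_(0 <= j < m) F j by rewrite big_mkord.
pose h := m./2.
have mh : m = (h + h + odd m)%N by rewrite addnn addnC odd_double_half.
have pair j : (j < h)%N -> phi (e * ln 2) <= F j + F (h + j)%N.
  move=> jh.
  have lnj : ln 2 <= ln (h + j).+1%:R - ln j.+1%:R :> R.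
    rewrite lerBrDr -lnM ?posrE ?ltr0n //.
    rewrite ler_ln ?posrE ?mulr_gt0 ?ltr0n //.
    by rewrite -natrM ler_nat; lia.
  have big (x : R) : ln 2 / 2 <= `|x| -> phi (e * ln 2) <= phi (2 * t * x).
    move=> xl; apply: phi_mono; rewrite !normrM (gtr0_norm e0) (gtr0_norm ln2).
    rewrite (_ : e * ln 2 = 2 * e * (ln 2 / 2)); last by field.
    apply: ler_pM => //; [lra|lra|].
    by rewrite ger0_norm // ler_wpM2l.
  have [xj|xj] := leP (ln 2 / 2) `|ln j.+1%:R - L|.
    by rewrite -[leLHS]addr0; apply: lerD; [exact: big|exact: phi0].
  rewrite -[leLHS]add0r; apply: lerD; first exact: phi0.
  apply: big.
  apply: le_trans (ler_norm _); move: xj; rewrite ltr_norml => /andP[+ _].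
  by lra.
have sumF : h%:R * phi (e * ln 2) <= \sum_(0 <= j < m) F j.
  rewrite [in leRHS]mh (big_cat_nat _ (n := (h + h)%N)) ?leq_addr //=.
  rewrite -[leLHS]addr0; apply: lerD; last first.
    by apply: sumr_ge0 => i _; exact: phi0.
  have up : \sum_(h <= j < h + h) F j = \sum_(0 <= j < h) F (h + j)%N.
    rewrite -{1}[h]add0n big_addn addnK.
    by apply: eq_bigr => j _; rewrite addnC.
  rewrite (big_cat_nat _ (n := h)) ?leq_addr //= up -big_split /=.
  rewrite mulr_natl -[X in _ *+ X]subn0 -sumr_const_nat.
  rewrite [leLHS]big_nat_cond [leRHS]big_nat_cond.
  by apply: ler_sum => j /andP[/andP[_ jh] _]; exact: pair.
have m0 : 0 < m%:R :> R by rewrite ltr0n; lia.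
rewrite ler_pdivlMl // ; apply: le_trans sumF.
rewrite mulrC -mulrA -[leRHS]mulrC ler_wpM2l //.
rewrite mulrC ler_pdivrMr // -natrM ler_nat.
by lia.
Qed.

(** Jensen's inequality keeps every factor at least 1; one coordinate with
    |theta| >= e suffices for a gain that does not depend on m. *)
Lemma prod_mean_weights_ge n (m : nat) (e : R) (theta : 'I_n -> R) :
  (1 < m)%N -> 0 < e -> (exists k, e <= `|theta k|) ->
  1 + Num.min ((e * ln 2) ^+ 2 / 4) 1 / 3
  <= \prod_r mean (fun j : 'I_m => expR (theta r * ctr_log j) ^+ 2).
Proof.
move=> m1 e0 [k ek]; set c := Num.min _ _ / 3.
have m0 : (0 < m)%N by lia.
have H r : 1 + mean (fun j : 'I_m =>
      Num.min ((2 * theta r * ctr_log j) ^+ 2 / 4) 1)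
    <= mean (fun j : 'I_m => expR (theta r * ctr_log j) ^+ 2).
  rewrite (_ : (fun j : 'I_m => expR _ ^+ 2) =
               fun j => expR (2 * theta r * ctr_log j)).
    by apply: mean_expR_ge => //; rewrite -mulr_sumr sum_centered // mulr0.
  by apply/funext => j; rewrite -expRM_natl -mulrA.
have H1 r : 1 <= mean (fun j : 'I_m => expR (theta r * ctr_log j) ^+ 2).
  apply: le_trans (H r); rewrite lerDl mulr_ge0 ?invr_ge0 ?ler0n //.
  by apply: sumr_ge0 => j _; rewrite le_min divr_ge0 ?sqr_ge0 ?ler01 ?ler0n.
rewrite (bigD1 k) //= -[leLHS]mulr1; apply: ler_pM => //.
- rewrite addr_ge0 // divr_ge0 // le_min ler01 divr_ge0 ?sqr_ge0 //.
- by apply: le_trans (H k); rewrite lerD2l; exact: mean_spread_ge.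
- by elim/big_ind : _ => // x y; exact: mulr_ege1.
Qed.

(** The same eta serves all sample sizes and all theta.  It is chosen so that
    the relative gain 1 + c of the weights beats the loss K eta on both sides:
    (1 + c) (det G - K eta) > det G + K eta. *)
Lemma det_separation n (G : 'M[R]_n) (e : R) : pos_def G -> 0 < e ->
  exists2 eta, 0 < eta &
  forall (m : nat) (M : 'I_m -> 'M[R]_n) (theta : 'I_n -> R), (1 < m)%N ->
  (forall j r s, `|M j r s - G r s| <= eta) -> (exists k, e <= `|theta k|) ->
  0 < \det (\matrix_(r, s) mean (fun j => M j r s)) <
      \det (\matrix_(r, s) mean (fun j =>
        expR (theta r * ctr_log j) * expR (theta s * ctr_log j) * M j r s)).
Proof.
move=> pG e0; pose c : R := Num.min ((e * ln 2) ^+ 2 / 4) 1 / 3.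
have c0 : 0 < c.
  rewrite divr_gt0 // lt_min ltr01 andbT divr_gt0 // exprn_gt0 // mulr_gt0 //.
  by rewrite ln_gt0 //; lra.
pose B : R := \sum_r \sum_s `|G r s|.
have B0 : 0 <= B by apply: sumr_ge0 => r _; exact: sumr_ge0.
have GB r s : `|G r s| <= B.
  rewrite /B (bigD1 r) //= (bigD1 s) //= -addrA lerDl addr_ge0 ?sumr_ge0 //.
  by move=> i _; exact: sumr_ge0.
have g0 := pos_def_det_gt0 pG; set g := \det G in g0.
pose K := det_modulus n B; have K0 : 0 <= K by exact: det_modulus_ge0.
have den0 : 0 < (2 + c) * (K + 1) by rewrite mulr_gt0 //; lra.
pose eta := Num.min 1 (c * g / ((2 + c) * (K + 1))).
have eta0 : 0 < eta by rewrite lt_min ltr01 divr_gt0 // mulr_gt0.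
exists eta => // m M theta m1 MG thetak.
have eta01 : 0 <= eta <= 1 by rewrite ltW // ge_min lexx.
have Keta : (2 + c) * (K * eta) < c * g.
  have : eta <= c * g / ((2 + c) * (K + 1)) by rewrite ge_min lexx orbT.
  rewrite ler_pdivlMr // => h; apply: lt_le_trans h.
  rewrite -subr_gt0.
  have -> : eta * ((2 + c) * (K + 1)) - (2 + c) * (K * eta) = (2 + c) * eta.
    by ring.
  by rewrite mulr_gt0 //; lra.
have Keta0 : 0 <= K * eta by rewrite mulr_ge0 // ltW.
have ckk : 0 <= c * (K * eta) by rewrite mulr_ge0 // ltW.
have Kg : 0 < g - K * eta.
  rewrite subr_gt0 -(ltr_pM2l c0); apply: le_lt_trans Keta; lra.
have m0 : 0 < m%:R :> R by rewrite ltr0n; lia.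
have det0 : `|\det (\matrix_(r, s) mean (fun j => M j r s)) - g| <= K * eta.
  apply: det_lipschitz => // r s; rewrite mxE.
  have -> : mean (fun j => M j r s) - G r s = mean (fun j => M j r s - G r s).
    rewrite /mean sumrB mulrBr sumr_const card_ord -(mulr_natl (G r s)) mulKf //.
    by rewrite gt_eqF.
  rewrite normrM gtr0_norm ?invr_gt0 // ler_pdivrMl //.
  apply: (le_trans (ler_norm_sum _ _ _)).
  apply: (@le_trans _ _ (\sum_(j < m) eta)); first exact: ler_sum.
  by rewrite sumr_const card_ord mulr_natl.
move: det0; rewrite ler_distl => /andP[lo hi].
apply/andP; split; first exact: lt_le_trans lo.
apply: (le_lt_trans hi).
pose w (j : 'I_m) r : R := expR (theta r * ctr_log j).
have W0 r : 0 < \sum_j w j r ^+ 2.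
  rewrite (bigD1 (Ordinal (ltnW m1))) //= ltr_pwDl ?exprn_gt0 ?expR_gt0 //.
  by apply: sumr_ge0 => j _; exact: sqr_ge0.
have := weighted_det_ge pG eta01 B0 GB MG W0; rewrite -/K -/g.
set N := \matrix_(r, s) \sum_j _ => detN.
have -> : \matrix_(r, s) mean (fun j =>
    expR (theta r * ctr_log j) * expR (theta s * ctr_log j) * M j r s)
    = m%:R^-1 *: N.
  by apply/matrixP => r s; rewrite !mxE.
rewrite detZ.
apply: (@lt_le_trans _ _ (m%:R^-1 ^+ n *
    ((\prod_r \sum_j w j r ^+ 2) * (g - K * eta)))); last first.
  by rewrite ler_wpM2l // exprn_ge0 // invr_ge0 ltW.
have := prod_mean_weights_ge m1 e0 thetak; rewrite -/c /mean.
rewrite big_split /= prodr_const card_ord => pw.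
rewrite mulrA; apply: (@lt_le_trans _ _ ((1 + c) * (g - K * eta))).
  by lra.
by rewrite ler_wpM2r // ltW.
Qed.

End Separation.

(** * Complex moduli and phases *)

Section ComplexModulus.
Local Open Scope complex_scope.
Local Open Scope ring_scope.
Context (R : realType).
Implicit Types (z : R[i]) (x : R).

Lemma rnormE z : rnorm z = Num.sqrt (complex.Re z ^+ 2 + complex.Im z ^+ 2).
Proof. by rewrite /rnorm normc_def. Qed.

Lemma rnormD z1 z2 : rnorm (z1 + z2) <= rnorm z1 + rnorm z2.
Proof. by have := ler_normD z1 z2; rewrite lecE => /andP[_]; rewrite raddfD. Qed.

Lemma rnormB z1 z2 : rnorm (z1 - z2) <= rnorm z1 + rnorm z2.
Proof. by rewrite (le_trans (rnormD _ _)) // /rnorm normrN. Qed.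

Lemma norm_Re_le z : `|complex.Re z| <= rnorm z.
Proof. by have := normc_ge_Re z; rewrite lecE => /andP[_]. Qed.

Lemma rnorm_expiM x z : rnorm (expi x * z) = rnorm z.
Proof.
have -> : rnorm (expi x * z) = rnorm (expi x) * rnorm z.
  by rewrite /rnorm normrM !normc_def -rmorphM.
by rewrite rnormE /= cos2Dsin2 sqrtr1 mul1r.
Qed.

Lemma expiNK x z : expi (- x) * (expi x * z) = z.
Proof.
have -> : expi (- x) * (expi x * z) = (expi (- x) * expi x) * z by rewrite mulrA.
suff -> : expi (- x) * expi x = 1 by rewrite mul1r.
rewrite /expi cosN sinN; apply/eqP; rewrite eq_complex /=.
by rewrite mulNr opprK -!expr2 cos2Dsin2 mulNr [sin x * _]mulrC subrr !eqxx.
Qed.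

(** Undoing the phase phi turns the discrepancy of the rotated estimate into
    one between its real part and the real part of exp (- i phi) g. *)
Lemma Re_unrotate (phi g : R) z :
  `|complex.Re z - g * cos phi| <= rnorm (expi phi * z - g%:C).
Proof.
have -> : complex.Re z - g * cos phi =
    complex.Re (expi (- phi) * (expi phi * z - g%:C)).
  rewrite mulrBr expiNK raddfB /= cosN mulr0 subr0.
  by rewrite [cos phi * _]mulrC.
by apply: (le_trans (norm_Re_le _)); rewrite rnorm_expiM.
Qed.

Lemma Re_realM x z : complex.Re (x%:C * z) = x * complex.Re z.
Proof. by case: z => a b /=; rewrite mul0r subr0. Qed.

End ComplexModulus.

(** A summand is the difference of two windows that differ by it.  Windows have
    at least two elements: for j > 2 they start at 1, while for j <= 2 they end
    at 4, whence the lower bound on m. *)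
Lemma rnorm_term_le (R : realType) (t : nat -> R[i]) (m : nat) (D : R) :
  (3 < m)%N ->
  (forall u v, (1 <= u)%N -> (u < v <= m)%N ->
     rnorm (\sum_(u <= j < v.+1) t j) <= D) ->
  forall j, (1 <= j <= m)%N -> rnorm (t j) <= D + D.
Proof.
move=> m3 H j /andP[j1 jm]; have [j2|j2] := leqP j 2.
  have -> : t j = \sum_(j <= i < 5) t i - \sum_(j.+1 <= i < 5) t i.
    by rewrite big_ltn ?addrK //; lia.
  by apply: (le_trans (rnormB _ _)); apply: lerD; apply: H; lia.
case: j j1 jm j2 => // j _ jm j2.
have -> : t j.+1 = \sum_(1 <= i < j.+2) t i - \sum_(1 <= i < j.+1) t i.
  by rewrite [X in X - _]big_nat_recr //= addrAC subrr add0r.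
by apply: (le_trans (rnormB _ _)); apply: lerD; apply: H; lia.
Qed.

(** * The objective function at a fixed sample point *)

Section Deterministic.
Local Open Scope complex_scope.
Local Open Scope ring_scope.
Context (R : realType) (dT : measure_display) (T : measurableType dT) (q : nat).
Variables (fn : nat -> R -> T -> 'M[R[i]]_q) (d0 : 'cV[R]_q).
Variables (m : nat -> nat) (n : nat) (w : T).

Definition rescaled_est (j : nat) : 'M[R]_q := \matrix_(r, s)
  complex.Re ((freq R n j `^ (d0 r 0 + d0 s 0))%:C * fn n (freq R n j) w r s).

Definition limit_mx (G0 : 'M[R]_q) : 'M[R]_q :=
  \matrix_(r, s) (G0 r s * cos (pi * (d0 r 0 - d0 s 0) / 2)).

(** The cosine of a difference is the Gram matrix of the unit vectors
    (cos (pi d0_r / 2), sin (pi d0_r / 2)). *)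
Lemma pos_def_limit_mx (G0 : 'M[R]_q) : pos_def G0 -> pos_def (limit_mx G0).
Proof.
move=> pG0; pose a (b : bool) (r : 'I_q) : R :=
  if b then cos (pi * d0 r 0 / 2) else sin (pi * d0 r 0 / 2).
have -> : limit_mx G0 = hadamard_gram G0 a.
  apply/matrixP => r s; rewrite !mxE big_bool /= -cosB.
  by congr (_ * cos _); ring.
by apply: pos_def_hadamard_gram => // r; rewrite big_bool /= cos2Dsin2.
Qed.

Lemma rescaled_est_near (G0 : 'M[R]_q) (eta : R) :
  (3 < m n)%N ->
  (forall j r s, (1 <= j <= m n)%N ->
     `|G0 r s| * `|cos ((freq R n j - pi) * (d0 r 0 - d0 s 0) / 2) -
       cos (pi * (d0 r 0 - d0 s 0) / 2)| <= eta / 2) ->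
  max_discrepancy fn G0 d0 m n w <= eta / 4 ->
  forall j r s, (1 <= j <= m n)%N ->
    `|rescaled_est j r s - limit_mx G0 r s| <= eta.
Proof.
move=> m3 Hcos Hmax j r s jm; rewrite !mxE.
set phi := (freq R n j - pi) * (d0 r 0 - d0 s 0) / 2.
set z := _ * fn _ _ _ _ _.
have -> : complex.Re z - G0 r s * cos (pi * (d0 r 0 - d0 s 0) / 2) =
  (complex.Re z - G0 r s * cos phi) +
  G0 r s * (cos phi - cos (pi * (d0 r 0 - d0 s 0) / 2)) by ring.
apply: (le_trans (ler_normD _ _)).
rewrite (_ : eta = (eta / 4 + eta / 4) + eta / 2); last by field.
apply: lerD; last by rewrite normrM; exact: Hcos.
apply: (le_trans (Re_unrotate _ _ _)).
pose t j : R[i] := expi ((freq R n j - pi) * (d0 r 0 - d0 s 0) / 2) *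
       (freq R n j `^ (d0 r 0 + d0 s 0))%:C * fn n (freq R n j) w r s
       - (G0 r s)%:C.
have -> : expi phi * z - (G0 r s)%:C = t j by rewrite /t mulrA.
apply: (@rnorm_term_le _ _ (m n)) => // u v u1 /andP[uv vm].
apply: le_trans Hmax; rewrite /max_discrepancy.
apply: (@bigmax_sup_seq _ _ _ _ _ u) => //; first by rewrite mem_index_iota; lia.
apply: (@bigmax_sup_seq _ _ _ _ _ v) => //; first by rewrite mem_index_iota; lia.
apply: (@bigmax_sup _ _ _ _ r) => //.
by apply: (@bigmax_sup _ _ _ _ s).
Qed.

Let logmean : R := (m n)%:R^-1 * \sum_(1 <= j < (m n).+1) ln (freq R n j).

(* The matrix whose determinant carries the dependence of the objective on d. *)
Let H (d : 'cV[R]_q) : 'M[R]_q := \matrix_(r, s) mean (fun j : 'I_(m n) =>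
  expR ((d r 0 - d0 r 0) * ctr_log R j) * expR ((d s 0 - d0 s 0) * ctr_log R j)
  * rescaled_est j.+1 r s).

Hypothesis n0 : (0 < n)%N.
Hypothesis m0 : (0 < m n)%N.

Lemma freq_gt0 j : (0 < j)%N -> 0 < freq R n j.
Proof. by move=> j0; rewrite divr_gt0 ?ltr0n // !mulr_gt0 ?pi_gt0 ?ltr0n. Qed.

Lemma ln_freq (j : 'I_(m n)) : ln (freq R n j.+1) = ctr_log R j + logmean.
Proof.
pose c : R := ln (2 * pi / n%:R).
have lnE k : ln (freq R n k.+1) = ln k.+1%:R + c.
  have a0 : 0 < 2 * pi / n%:R :> R.
    by rewrite divr_gt0 ?ltr0n // !mulr_gt0 ?pi_gt0.
  rewrite /c -lnM ?posrE ?ltr0n //; congr ln.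
  by rewrite /freq; ring.
have mn0 : (m n)%:R != 0 :> R by rewrite pnatr_eq0 -lt0n.
rewrite /logmean big_add1 /= big_mkord.
under eq_bigr => k _ do rewrite lnE.
rewrite big_split /= sumr_const card_ord -(mulr_natl c) mulrDr mulKf //.
by rewrite lnE /ctr_log /mean; ring.
Qed.

Lemma powR_freq (j : 'I_(m n)) a :
  freq R n j.+1 `^ a = expR (a * ctr_log R j) * expR (a * logmean).
Proof.
by rewrite /powR gt_eqF ?freq_gt0 // ln_freq mulrDr expRD.
Qed.

(** With log lambda_j = ctr_log j + logmean, the factors exp (theta logmean)
    do not depend on j and leave the average. *)
Lemma GhatE d : Ghat fn m n w d =
  diag_mx (\row_r expR ((d r 0 - d0 r 0) * logmean)) *m H d *m
  diag_mx (\row_r expR ((d r 0 - d0 r 0) * logmean)).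
Proof.
apply/matrixP => r s; rewrite mul_mx_diag mul_diag_mx !mxE /mean.
rewrite summxE big_add1 /= big_mkord mulrCA -mulrA; congr (_ * _).
rewrite mulr_sumr mulr_suml; apply: eq_bigr => j _.
rewrite [LHS]mxE /= mul_mx_diag mul_diag_mx !mxE.
set z := fn _ _ _ _ _.
rewrite mulrAC -rmorphM !Re_realM !powR_freq !mulrBl !mulrDl !expRD !expRN.
have e0 x : expR x != 0 :> R by rewrite gt_eqF ?expR_gt0.
by field; rewrite !e0.
Qed.

(** The diagonal factors of GhatE contribute 2 logmean sum_k (d_k - d0_k) to the
    log-determinant, which the linear term cancels up to a constant in d. *)
Lemma objectiveE d : 0 < \det (H d) ->
  objective fn m n w d =
  (ln (\det (H d)) - 2 * \sum_(k < q) d0 k 0 * logmean)%:E.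
Proof.
move=> H0; rewrite /objective GhatE !det_mulmx det_diag.
set p := \prod_i _.
have pE : p = expR (\sum_(k < q) (d k 0 - d0 k 0) * logmean).
  by rewrite expR_sum; apply: eq_bigr => k _; rewrite mxE.
have p0 : 0 < p by rewrite pE expR_gt0.
rewrite lne_EFin ?mulr_gt0 // -EFinB; congr EFin.
rewrite !lnM ?posrE ?mulr_gt0 // pE expRK.
under eq_bigr => k _ do rewrite mulrBl.
by rewrite sumrB -/logmean; ring.
Qed.

(** Separation gives both determinants a positive sign, so the two values of
    the objective are finite and compare like the determinants. *)
Lemma no_distant_argmin (Theta : set 'cV[R]_q) (G : 'M[R]_q) (e eta : R) d :
  (1 < m n)%N ->
  (forall (M : 'I_(m n) -> 'M[R]_q) (theta : 'I_q -> R),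
    (forall j r s, `|M j r s - G r s| <= eta) ->
    (exists k, e <= `|theta k|) ->
    0 < \det (\matrix_(r, s) mean (fun j => M j r s)) <
      \det (\matrix_(r, s) mean (fun j =>
      expR (theta r * ctr_log R j) * expR (theta s * ctr_log R j) * M j r s))) ->
  (forall j r s, (1 <= j <= m n)%N -> `|rescaled_est j r s - G r s| <= eta) ->
  Theta d0 -> is_argmin Theta (objective fn m n w) d ->
  ~ exists k, e <= `|d k 0 - d0 k 0|.
Proof.
move=> m1 sep Gnear Td0 [_ /(_ _ Td0) dmin] dk.
have Gn (j : 'I_(m n)) r s : `|rescaled_est j.+1 r s - G r s| <= eta.
  by apply: Gnear; rewrite ltn_ord.
have := sep (fun j => rescaled_est j.+1) (fun k => d k 0 - d0 k 0) Gn dk.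
have -> : \matrix_(r, s) mean (fun j : 'I_(m n) => rescaled_est j.+1 r s) = H d0.
  apply/matrixP => r s; rewrite !mxE; congr (_ * _); apply: eq_bigr => j _.
  by rewrite !subrr !mul0r expR0 !mul1r.
rewrite -/(H d) => /andP[Hd0 lt]; have Hd := lt_trans Hd0 lt.
move: dmin; rewrite !objectiveE // lee_fin lerD2r ler_ln ?posrE //.
by rewrite leNgt lt.
Qed.

End Deterministic.

(** * Measurability *)

Section Measurability.
Local Open Scope complex_scope.
Local Open Scope ring_scope.
Context (R : realType) (dT : measure_display) (T : measurableType dT)
        (P : probability T R) (q : nat).

Lemma sigma_of_sub (I : Type) (D : set I) (Y : I -> {RV P >-> R}) :
  sigma_of D (fun i => Y i) `<=` measurable.
Proof.
apply: smallest_sub; first exact: sigma_algebra_measurable.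
by move=> B [i _ [C mC <-]]; exact: measurable_funPTI.
Qed.

Lemma measurable_bigmaxr (I : Type) (s : seq I) (h : I -> T -> R) :
  (forall i, measurable_fun setT (h i)) ->
  measurable_fun setT (fun w => \big[Num.max/0]_(i <- s) h i w).
Proof.
move=> mh; elim: s => [|i s IHs].
  by under eq_fun do rewrite big_nil; exact: measurable_cst.
under eq_fun do rewrite big_cons.
exact: measurable_realfun.measurable_maxr.
Qed.

Lemma measurable_gtr (f : T -> R) e :
  measurable_fun setT f -> measurable [set w | e < f w].
Proof.
move=> mf; have -> : [set w | e < f w] = setT `&` f @^-1` `]e, +oo[.
  by rewrite setTI; apply/seteqP; split => w /=; rewrite in_itv /= andbT.
exact: mf.
Qed.

Definition cmeasurable (z : T -> R[i]) : Prop :=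
  measurable_fun setT (fun w => complex.Re (z w)) /\
  measurable_fun setT (fun w => complex.Im (z w)).

Lemma cmeasurable_affine (z : T -> R[i]) (a b : R[i]) :
  cmeasurable z -> cmeasurable (fun w => a * z w - b).
Proof.
case: a b => a1 a2 [b1 b2] [mRe mIm].
have E1 w : complex.Re ((a1 +i* a2) * z w - (b1 +i* b2)) =
    a1 * complex.Re (z w) - a2 * complex.Im (z w) - b1.
  by case: (z w).
have E2 w : complex.Im ((a1 +i* a2) * z w - (b1 +i* b2)) =
    a1 * complex.Im (z w) + a2 * complex.Re (z w) - b2.
  by case: (z w).
split; [under eq_fun do rewrite E1|under eq_fun do rewrite E2].
  apply: measurable_realfun.measurable_funB; last exact: measurable_cst.
  by apply: measurable_realfun.measurable_funB;
    apply: measurable_realfun.measurable_funM.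
apply: measurable_realfun.measurable_funB; last exact: measurable_cst.
by apply: measurable_realfun.measurable_funD;
  apply: measurable_realfun.measurable_funM.
Qed.

Lemma cmeasurable_sum (I : Type) (s : seq I) (z : I -> T -> R[i]) :
  (forall i, cmeasurable (z i)) -> cmeasurable (fun w => \sum_(i <- s) z i w).
Proof.
move=> mz; split.
  under eq_fun do rewrite raddf_sum.
  by apply: measurable_sum => i; case: (mz i).
under eq_fun do rewrite raddf_sum.
by apply: measurable_sum => i; case: (mz i).
Qed.

Lemma measurable_rnorm (z : T -> R[i]) :
  cmeasurable z -> measurable_fun setT (fun w => rnorm (z w)).
Proof.
case=> mRe mIm; under eq_fun do rewrite rnormE.
apply: (measurableT_comp
  (measurable_realfun.continuous_measurable_fun (@sqrt_continuous R))).
by apply: measurable_realfun.measurable_funD;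
  apply: measurable_realfun.measurable_funX.
Qed.

(** Needed because the convergence hypothesis speaks of the probability of an
    event of this variable, to which another event is compared. *)
Lemma measurable_max_discrepancy (X : nat -> 'I_q -> {RV P >-> R})
  (fn : nat -> R -> T -> 'M[R[i]]_q) G0 d0 m n :
  based_on_observations X fn -> (0 < n)%N ->
  measurable_fun setT (max_discrepancy fn G0 d0 m n).
Proof.
move=> hfn n0.
apply: measurable_bigmaxr => u; apply: measurable_bigmaxr => v.
apply: measurable_bigmaxr => r; apply: measurable_bigmaxr => s.
apply: measurable_rnorm; apply: cmeasurable_sum => j.
apply: cmeasurable_affine; have [mRe mIm] := hfn n (freq R n j) r s n0.
split=> _ Y mY; rewrite setTI.
  exact: (sigma_of_sub (Y := fun i => X i.1 i.2) (mRe Y mY)).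
exact: (sigma_of_sub (Y := fun i => X i.1 i.2) (mIm Y mY)).
Qed.

Lemma norm_cV_gt (x : 'cV[R]_q) (e : R) : 0 <= e ->
  e < `|x| -> exists k, e < `|x k 0|.
Proof.
move=> e0; rewrite /Num.norm /= mx_normrE => /bigmax_gtP[|[[k j] _ /=]].
  by rewrite ltNge e0.
by rewrite ord1; exists k.
Qed.

Lemma measurable_dist_gt (Y : 'I_q -> {RV P >-> R}) (y : 'cV[R]_q) (e : R) :
  measurable [set w | e < `|rvec Y w - y|].
Proof.
apply: measurable_gtr.
rewrite /Num.norm /=; under eq_fun do rewrite mx_normrE.
apply: measurable_bigmaxr => -[k j] /=.
apply: (measurableT_comp (measurable_realfun.normr_measurable (D := setT))).
under eq_fun do rewrite !mxE.
by apply: measurable_realfun.measurable_funB.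
Qed.

End Measurability.

(** * Large samples *)

Section Asymptotics.
Context (R : realType).

Lemma A4_freq (m : nat -> nat) (b : R) :
  (forall n, (0 < n)%N -> (0 < m n)%N) -> A4 R m -> 0 < b ->
  \forall n \near \oo,
    (0 < n)%N /\ (3 < m n)%N /\
    forall j, (1 <= j <= m n)%N -> `|freq R n j| < b.
Proof.
move=> hm A4m b0.
have pi0 : 0 < 2 * pi :> R by rewrite mulr_gt0 ?pi_gt0.
pose c : R := Num.min (1 / 4) (b / (2 * pi)).
have c0 : 0 < c by rewrite lt_min !divr_gt0.
near=> n.
have n0 : (0 < n)%N by near: n; exact: nbhs_infty_gt.
have nR : 0 < n%:R :> R by rewrite ltr0n.
have mR : 0 < (m n)%:R :> R by rewrite ltr0n hm.
have mn0 : 0 <= (m n)%:R / n%:R :> R by rewrite divr_ge0.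
have mi0 : 0 < (m n)%:R^-1 :> R by rewrite invr_gt0.
have : `|((m n)%:R : R)^-1 + (m n)%:R / n%:R| < c.
  by near: n; apply: (cvgr_norm_lt _ A4m); rewrite normr0 c0.
rewrite ger0_norm ?addr_ge0 ?(ltW mi0) // lt_min => /andP[mlarge msmall].
split => //; split.
  have : (m n)%:R^-1 < 4^-1 :> R by lra.
  by rewrite ltf_pV2 ?posrE ?ltr0n ?hm // ltr_nat => /ltnW.
move=> j /andP[j1 jm]; rewrite ger0_norm; last first.
  by rewrite divr_ge0 // mulr_ge0 // ltW.
have : (m n)%:R / n%:R < b / (2 * pi) by lra.
rewrite ltr_pdivlMr //; apply: le_lt_trans.
have -> : freq R n j = j%:R / n%:R * (2 * pi) by rewrite /freq; ring.
by rewrite ler_pM2r // ler_pM2r ?invr_gt0 // ler_nat.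
Unshelve. all: by end_near. Qed.

(** Continuity of the cosine at lambda = 0, uniform over the finitely many
    pairs (r, s); the cosine is even, which reconciles the two signs of pi. *)
Lemma cos_phase_near (q : nat) (G0 : 'M[R]_q) (d0 : 'cV[R]_q) (e : R) :
  0 < e -> exists2 b : R, 0 < b & forall l r s, `|l| < b ->
     `|G0 r s| * `|cos ((l - pi) * (d0 r 0 - d0 s 0) / 2) -
       cos (pi * (d0 r 0 - d0 s 0) / 2)| <= e.
Proof.
move=> e0.
pose Q (rs : 'I_q * 'I_q) (l : R) : Prop :=
    `|G0 rs.1 rs.2| * `|cos ((l - pi) * (d0 rs.1 0 - d0 rs.2 0) / 2) -
       cos (pi * (d0 rs.1 0 - d0 rs.2 0) / 2)| <= e.
have /nbhs_ballP[b /= b0 Hb] : \forall l \near (0 : R), forall rs, Q rs l.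
  apply: (@filter_forall _ _ Q _ (nbhs_filter (0 : R))) => -[r s]; rewrite /Q /=.
  set a := d0 r 0 - d0 s 0.
  have g0 : 0 < `|G0 r s| + 1 by rewrite ltr_wpDl.
  pose F (l : R) : R := cos ((l - pi) * a / 2).
  have F0 : F 0 = cos (pi * a / 2) by rewrite /F sub0r !mulNr cosN.
  have cF : F l @[l --> (0 : R)] --> F 0.
    apply: (@cvg_comp _ _ _ (fun l : R => (l - pi) * a / 2) cos _ _ _ _
      (@continuous_cos R ((0 - pi) * a / 2))).
    do 2 (apply: cvgM; last exact: cvg_cst).
    by apply: cvgB; [exact: cvg_id|exact: cvg_cst].
  have h0 : 0 < e / (`|G0 r s| + 1) by rewrite divr_gt0.
  move/cvgrPdist_le/(_ _ h0) : cF; apply: filterS => l.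
  rewrite F0 /F.
  rewrite distrC => h.
  apply: (@le_trans _ _ (`|G0 r s| * (e / (`|G0 r s| + 1)))).
    by rewrite ler_wpM2l.
  rewrite mulrCA ler_piMr ?(ltW e0) // ler_pdivrMr // mul1r.
  by rewrite lerDl.
exists b => // l r s lb; apply: (Hb l _ (r, s)).
by rewrite /ball /= sub0r normrN.
Qed.

End Asymptotics.

(** * Consistency *)

Theorem theorem3p2 (R : realType) (dT : measure_display)
  (T : measurableType dT) (P : probability T R) (q : nat) (hq : (0 < q)%N)
  (X : nat -> 'I_q -> {RV P >-> R}) (f : R -> 'M[R[i]]_q)
  (hX : weakly_stationary X) (hf : spectral_density X f)
  (Theta : set 'cV[R]_q)
  (hTheta : forall d, Theta d -> forall i, - (1 / 2) < d i 0 < 1 / 2)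
  (d0 : 'cV[R]_q) (hd0 : Theta d0)
  (G0 : 'M[R]_q) (hG0 : pos_def G0)
  (m : nat -> nat) (hm : forall n, (0 < n)%N -> (0 < m n)%N)
  (fn : nat -> R -> T -> 'M[R[i]]_q)
  (hfn : based_on_observations X fn)
  (hdisc : cvg_in_prob P (max_discrepancy fn G0 d0 m) 0)
  (A : nat -> 'M[R]_q) (eps : int -> 'I_q -> {RV P >-> R})
  (hA1 : A1 f G0 d0) (hA2 : A2 X A eps) (hA3 : A3 A) (hA4 : A4 R m)
  (dhat : nat -> 'I_q -> {RV P >-> R})
  (hdhat : forall n, (0 < n)%N ->
     {ae P, forall w, is_argmin Theta (objective fn m n w) (rvec (dhat n) w)}) :
  cvg_in_prob P (fun n w => rvec (dhat n) w) d0.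
Proof.
move=> e e0.
have [eta eta0 sep] := det_separation (pos_def_limit_mx d0 hG0) e0.
have eta4 : 0 < eta / 4 by rewrite divr_gt0.
have eta2 : 0 < eta / 2 by rewrite divr_gt0.
have [b b0 phase] := cos_phase_near G0 d0 eta2.
apply: (@squeeze_cvge _ _ _ _ (cst 0%E) _
  (fun n => P [set w | eta / 4 < `|max_discrepancy fn G0 d0 m n w - 0|])).
- have := A4_freq hm hA4 b0; apply: filterS => n [n0 [m3 small]].
  rewrite measure_ge0 /=.
  (* Outside B and outside the null set where dhat fails to minimise, the
     deterministic argument applies. *)
  set B := [set w | eta / 4 < _]; set E := [set w | e < _].
  have mB : measurable B.
    apply: measurable_gtr.
    apply: (measurableT_comp (measurable_realfun.normr_measurable (D := setT))).
    apply: measurable_realfun.measurable_funB; last exact: measurable_cst.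
    exact: measurable_max_discrepancy hfn n0.
  have mE : measurable E by exact: measurable_dist_gt.
  have [N [mN PN0 subN]] := hdhat n n0.
  rewrite -(measureU0 (mu := P) mB mN PN0).
  apply: le_measure; rewrite ?inE //; first exact: measurableU.
  move=> w Ew; have [Bw|nBw] := pselect (B w); [by left|right].
  apply: subN => /= argm.
  have disc : max_discrepancy fn G0 d0 m n w <= eta / 4.
    apply: (le_trans (ler_norm _)); rewrite leNgt; apply/negP => lt.
    by apply: nBw; rewrite /B /= subr0.
  have m1 : (1 < m n)%N := ltnW (ltnW m3).
  apply: (no_distant_argmin (G := limit_mx d0 G0) (e := e) (eta := eta)
    n0 (ltnW m1) m1 _ _ hd0 argm).
  + by move=> M theta; exact: sep.
  + apply: rescaled_est_near => // j r s jm.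
    by apply: phase; exact: small.
  + have [k ek] := norm_cV_gt (ltW e0) Ew.
    by exists k; move: ek; rewrite !mxE; exact: ltW.
- exact: cvg_cst.
- exact: hdisc.
Qed.
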